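(* Let $\alpha\in(0,1]$, let $E\colon\mathbb{R}^n\to\mathbb{R}^n$ be a map, let $B\subseteq\mathbb{R}^n$ be an $E$-convex set, let $I=\{1,2,\dots,l\}$, and let $g_i\colon B\to\mathbb{R}^\alpha$, $i\in I$, be generalized $E$-convex functions on $B$. Then: (i) The function $g\colon B\to\mathbb{R}^\alpha$ defined by $g(r)=\sup_{i\in I}g_i(r)$, $r\in B$, is generalized $E$-convex on $B$. (ii) If $g_i$, $i=1,2,\dots,l$, are generalized $E$-quasiconvex functions on $B$, then the function $g$ is generalized $E$-quasiconvex on $B$.
   Context: $\mathbb{R}^\alpha=\{a^\alpha : a\in\mathbb{R}\}$ is the real linear fractal set (Yang's fractal real line), with $a^\alpha+b^\alpha=(a+b)^\alpha$, $a^\alpha b^\alpha=(ab)^\alpha$, and $a^\alpha\le b^\alpha$ iff $a\le b$; for $\eta\in[0,1]$, $\eta^\alpha$ denotes the corresponding element of $\mathbb{R}^\alpha$, so that $\eta^\alpha+(1-\eta)^\alpha=1^\alpha$. All notions below refer to one and the same map $E$. A set $B\subseteq\mathbb{R}^n$ is $E$-convex if $\eta E(r_1)+(1-\eta)E(r_2)\in B$ for all $r_1,r_2\in B$, $\eta\in[0,1]$. A function $g\colon B\to\mathbb{R}^\alpha$ on an $E$-convex set $B$ is generalized $E$-convex on $B$ if $g(\eta E(r_1)+(1-\eta)E(r_2))\le \eta^\alpha g(E(r_1))+(1-\eta)^\alpha g(E(r_2))$ for all $r_1,r_2\in B$, $\eta\in(0,1)$; it is generalized $E$-quasiconvex on $B$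 if $g(\eta E(r_1)+(1-\eta)E(r_2))\le\max\{g(E(r_1)),g(E(r_2))\}$ for all $r_1,r_2\in B$, $\eta\in[0,1]$. *)

(* Defs.v *)
From HB Require Import structures.
From mathcomp Require Import all_boot all_order all_algebra.
From mathcomp Require Import boolp classical_sets reals.

Set Implicit Arguments.
Unset Strict Implicit.
Unset Printing Implicit Defensive.

Import Order.TTheory GRing.Theory Num.Theory.

Local Open Scope classical_set_scope.
Local Open Scope ring_scope.

(* Yang's fractal real line R^alpha.  Its elements are the formal symbols
   a^alpha with a : R, not real powers: the operations and the order are those
   given by a^alpha + b^alpha = (a + b)^alpha, a^alpha b^alpha = (ab)^alpha and
   a^alpha <= b^alpha <-> a <= b.  The exponent alpha is therefore only an index
   of the type. *)
Record fractal (R : realType) (alpha : R) := Fpow { fbase : R }.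
Arguments Fpow {R} alpha a : rename.
Arguments fbase {R alpha} x : rename.

Section FractalStructures.
Context (R : realType) (alpha : R).
Local Notation F := (fractal alpha).
Implicit Types x y z : F.

HB.instance Definition _ := [isNew for @fbase R alpha].
HB.instance Definition _ := [Choice of F by <:].

Definition fadd x y : F := Fpow alpha (fbase x + fbase y).
Definition fopp x : F := Fpow alpha (- fbase x).
Definition fmul x y : F := Fpow alpha (fbase x * fbase y).
Definition fle x y := fbase x <= fbase y.

Fact faddA : associative fadd.
Proof. by move=> x y z; rewrite /fadd /= addrA. Qed.
Fact faddC : commutative fadd.
Proof. by move=> x y; rewrite /fadd addrC. Qed.
Fact fadd0 : left_id (Fpow alpha 0) fadd.
Proof. by case=> a; rewrite /fadd /= add0r. Qed.
Fact faddN : left_inverse (Fpow alpha 0) fopp fadd.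
Proof. by case=> a; rewrite /fadd /= addNr. Qed.
HB.instance Definition _ := GRing.isZmodule.Build F faddA faddC fadd0 faddN.

Fact fmulA : associative fmul.
Proof. by move=> x y z; rewrite /fmul /= mulrA. Qed.
Fact fmulC : commutative fmul.
Proof. by move=> x y; rewrite /fmul mulrC. Qed.
Fact fmul1 : left_id (Fpow alpha 1) fmul.
Proof. by case=> a; rewrite /fmul /= mul1r. Qed.
Fact fmulDl : left_distributive fmul +%R.
Proof.
by move=> x y z; apply: (congr1 (Fpow alpha)); exact: mulrDl.
Qed.
Fact foner_neq0 : Fpow alpha 1 != 0.
Proof. by apply/eqP => -[] /eqP; rewrite oner_eq0. Qed.
HB.instance Definition _ :=
  GRing.Zmodule_isComNzRing.Build F fmulA fmulC fmul1 fmulDl foner_neq0.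

Fact fle_refl : reflexive fle.
Proof. by move=> x; exact: lexx. Qed.
Fact fle_anti : antisymmetric fle.
Proof. by case=> a [b] /le_anti /= ->. Qed.
Fact fle_trans : transitive fle.
Proof. by move=> y x z; exact: le_trans. Qed.
HB.instance Definition _ :=
  Order.Le_isPOrder.Build ring_display F fle_refl fle_anti fle_trans.
Fact fle_total : total (<=%O : rel F).
Proof. by move=> x y; exact: le_total. Qed.
HB.instance Definition _ := Order.POrder_isTotal.Build ring_display F fle_total.

Lemma FpowD a b : Fpow alpha a + Fpow alpha b = Fpow alpha (a + b).
Proof. by []. Qed.
Lemma FpowM a b : Fpow alpha a * Fpow alpha b = Fpow alpha (a * b).
Proof. by []. Qed.
Lemma ler_Fpow a b : (Fpow alpha a <= Fpow alpha b) = (a <= b).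
Proof. by []. Qed.

End FractalStructures.

Section EConvexity.
Context (R : realType) (n : nat) (E : 'rV[R]_n -> 'rV[R]_n).
Implicit Types (B : set 'rV[R]_n) (alpha : R).

Definition E_convex_set B :=
  forall r1 r2, B r1 -> B r2 -> forall eta : R, 0 <= eta <= 1 ->
    B (eta *: E r1 + (1 - eta) *: E r2).

(* A function on B is represented by a total function.  When B is E-convex,
   every point at which g is evaluated below lies in B (take eta = 1 for
   E r1, eta = 0 for E r2), so the values of g outside B are irrelevant. *)
Definition generalized_E_convex alpha B (g : 'rV[R]_n -> fractal alpha) :=
  forall r1 r2, B r1 -> B r2 -> forall eta : R, 0 < eta < 1 ->
    g (eta *: E r1 + (1 - eta) *: E r2)
      <= Fpow alpha eta * g (E r1) + Fpow alpha (1 - eta) * g (E r2).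

Definition generalized_E_quasiconvex alpha B (g : 'rV[R]_n -> fractal alpha) :=
  forall r1 r2, B r1 -> B r2 -> forall eta : R, 0 <= eta <= 1 ->
    g (eta *: E r1 + (1 - eta) *: E r2) <= Num.max (g (E r1)) (g (E r2)).

End EConvexity.

(* Main.v *)
Require Import Defs.
From mathcomp Require Import all_boot all_order all_algebra.
From mathcomp Require Import boolp classical_sets reals.

Import Order.TTheory GRing.Theory Num.Theory.
Local Open Scope classical_set_scope.
Local Open Scope ring_scope.

(** A finite nonempty family attains its supremum ([supremum_finite_family]), so at
    [eta *: E r1 + (1 - eta) *: E r2], a point of [B], [g] coincides with some [g_ i]. The
    inequality for that single [g_ i] applies, and its right-hand side can only grow when [g_ i] is
    replaced by [g] at [E r1] and [E r2]: these points lie in [B], and both the weighted sum with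
    nonnegative weights and the maximum are monotone. *)

Lemma supremum_maximum d (T : porderType d) (x0 x : T) (A : set T) :
  A x -> ubound A x -> supremum x0 A = x.
Proof.
move=> Ax ubx; rewrite /supremum ifF; last by apply/negbTE/set0P; exists x.
have sx : supremums A x by split=> // y; exact.
(* [sx] rules out the default value of [xget]; uniqueness of suprema identifies its choice with
   [x]. *)
by case: xgetP => [y _ sy|/(_ x)//]; exact: (is_subset1_supremums sy sx).
Qed.

Lemma supremum_finite_family d (T : orderType d) (I : finType) (i0 : I)
    (x0 : T) (F : I -> T) :
  exists2 i, supremum x0 [set F i | i in [set: I]] = F i
    & forall j, (F j <= F i)%O.
Proof.
case: (@arg_maxP _ _ _ i0 xpredT F isT) => i _ Fi.
exists i => [|j]; last exact: Fi.
by apply: supremum_maximum => [|_ [j _ <-]]; [exists i | exact: Fi].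
Qed.

Lemma E_convex_set_image (R : realType) (n : nat) (E : 'rV[R]_n -> 'rV[R]_n)
    (B : set 'rV[R]_n) (r : 'rV[R]_n) :
  E_convex_set E B -> B r -> B (E r).
Proof.
move=> hB Br; have := hB r r Br Br 1.
by rewrite subrr scale1r scale0r addr0 ler01 lexx; exact.
Qed.

(* [fractal alpha] has a ring and an order structure but no numDomainType one,
   so the compatibility lemmas go through conversion to R. *)
Lemma ler_fractal_pM (R : realType) (alpha : R) (a : R) (x y : fractal alpha) :
  0 <= a -> x <= y -> Fpow alpha a * x <= Fpow alpha a * y.
Proof.
move=> a0 xy; suff: a * fbase x <= a * fbase y by [].
exact: ler_wpM2l.
Qed.

Lemma ler_fractalD (R : realType) (alpha : R) (x y z t : fractal alpha) :
  x <= y -> z <= t -> x + z <= y + t.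
Proof.
move=> xy zt; suff: fbase x + fbase z <= fbase y + fbase t by [].
exact: lerD.
Qed.

Theorem theorem2p3 (R : realType) (alpha : R) (n l : nat)
    (E : 'rV[R]_n -> 'rV[R]_n) (B : set 'rV[R]_n)
    (g_ : 'I_l -> 'rV[R]_n -> fractal alpha) (g : 'rV[R]_n -> fractal alpha)
    (halpha : 0 < alpha <= 1) (hl : (0 < l)%N)
    (hB : E_convex_set E B)
    (hg_ : forall i, generalized_E_convex E B (g_ i))
    (hg : forall r, B r -> g r = supremum 0 [set g_ i r | i in [set: 'I_l]]) :
  generalized_E_convex E B g /\
  ((forall i, generalized_E_quasiconvex E B (g_ i)) ->
    generalized_E_quasiconvex E B g).
Proof.
have sup_attained r : B r -> exists2 i, g r = g_ i r & forall j, g_ j r <= g_ i r.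
  move=> Br; rewrite hg //.
  have [i -> le_i] :=
    supremum_finite_family _ _ _ (Ordinal hl) (0 : fractal alpha) (g_^~ r).
  by exists i.
have le_g j r : B r -> g_ j r <= g r.
  by move=> /sup_attained[i -> ]; exact.
have BE r : B r -> B (E r) by exact: E_convex_set_image hB.
split=> [r1 r2 B1 B2 eta /andP[eta0 eta1]|hq r1 r2 B1 B2 eta eta01].
- have [|i -> _] := sup_attained (eta *: E r1 + (1 - eta) *: E r2).
    by apply: hB => //; rewrite !ltW.
  apply: le_trans (hg_ i r1 r2 B1 B2 eta _) _; first exact/andP.
  apply: ler_fractalD; apply: ler_fractal_pM.
  + exact: ltW.
  + exact/le_g/BE.
  + by rewrite subr_ge0 ltW.
  + exact/le_g/BE.
- have [|i -> _] := sup_attained (eta *: E r1 + (1 - eta) *: E r2).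
    exact: hB.
  apply: le_trans (hq i r1 r2 B1 B2 eta eta01) _.
  (* Each value of [g_ i] is bounded by the value of [g] at the same point, hence by the maximum. *)
  by rewrite ge_max !le_max !le_g ?orbT //; exact: BE.
Qed.
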